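(* Let $d$ be a positive integer. There are constants $C=C(d)$ (depending only on $d$) and $c>0$ such that the following holds. Let $\mathcal{H}$ be an ordered $3$-uniform hypergraph on $t$ vertices with maximum degree $d$ and let $s$ be a positive integer. Then \[\overline{R}(\mathcal{H},\mathcal{K}^{(3)}_3(s)) \leq t \cdot 2^{C s^{2-1/(1+cd^2)}}.\] In particular, for $s=t=n$ and bounded $d$, \[\overline{R}(\mathcal{H},\mathcal{K}^{(3)}_3(n)) \leq 2^{O(n^{2-1/(1+cd^2)})}.\]
   Context: An ordered $k$-uniform hypergraph is a pair $(H,<)$ of a $k$-uniform hypergraph $H$ and a linear ordering $<$ of its vertex set; $\mathcal{H}_1$ is an ordered subhypergraph of $\mathcal{H}_2$ if $H_1$ is a subhypergraph of $H_2$ and the order of $\mathcal{H}_1$ is the restriction of the order of $\mathcal{H}_2$; isomorphisms of ordered hypergraphs must preserve the orderings. $\mathcal{K}^{(k)}_N$ denotes the ordered complete $k$-uniform hypergraph on $N$ vertices. The ordered Ramsey number $\overline{R}(\mathcal{H},\mathcal{G})$ of ordered $k$-uniform hypergraphs $\mathcal{H},\mathcal{G}$ is the smallest $N$ such that every red-blue coloring of the hyperedges of $\mathcal{K}^{(k)}_N$ contains a blue ordered subhypergraph isomorphic to $\mathcal{H}$ or a red ordered subhypergraph isomorphic to $\mathcal{G}$. $\mathcal{K}^{(3)}_3(n)$ denotes the ordered complete $3$-uniform tripartite hypergraph whose vertex set consists of three consecutive intervals (all vertices of one precede all vertices of the next) of size $n$ each, with hyperedges exactly the triples containing one vertex from each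 interval. The degree of a vertex is the number of hyperedges containing it. *)

(* Defs.v *)
From HB Require Import structures.
From mathcomp Require Import all_boot all_order all_algebra.
From mathcomp Require Import reals exp.

Set Implicit Arguments.
Unset Strict Implicit.
Unset Printing Implicit Defensive.

Import Order.TTheory GRing.Theory Num.Theory.

(* The vertex set may be any subset of the finite totally ordered type [T] and
   carries the restriction of the order of [T]. *)
Record ohgraph (k : nat) (disp : Order.disp_t) (T : finOrderType disp) :=
  OHGraph {
    verts : {set T};
    edges : {set {set T}};
    edgesP : forall e, e \in edges -> e \subset verts /\ #|e| = k
  }.

Section OrderedHypergraphs.
Variables (k : nat) (disp : Order.disp_t) (T : finOrderType disp).
Implicit Types H G : ohgraph k T.

Definition degree H (v : T) : nat := #|[set e in edges H | v \in e]|.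

Definition max_degree H : nat := \max_(v in verts H) degree H v.

(* The orders agree automatically, both being restrictions of that of [T]. *)
Definition osubgraph H G : Prop :=
  verts H \subset verts G /\ edges H \subset edges G.

End OrderedHypergraphs.

Definition oiso (k : nat) (disp1 disp2 : Order.disp_t)
    (T1 : finOrderType disp1) (T2 : finOrderType disp2)
    (H : ohgraph k T1) (G : ohgraph k T2) : Prop :=
  exists f : T1 -> T2,
    [/\ {in verts H &, forall x y, (f x < f y)%O = (x < y)%O},
        f @: verts H = verts G
      & [set f @: (e : {set T1}) | e in edges H] = edges G].

Fact ocomplete_subproof (k N : nat) (e : {set 'I_N}) :
  e \in [set e : {set 'I_N} | #|e| == k] -> e \subset setT /\ #|e| = k.
Proof. by rewrite inE => /eqP ->; rewrite subsetT. Qed.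

Definition ocomplete (k N : nat) : ohgraph k 'I_N :=
  OHGraph (@ocomplete_subproof k N).

Definition interval (n : nat) (i : 'I_3) : {set 'I_(3 * n)} :=
  [set v : 'I_(3 * n) | i * n <= v < i.+1 * n].

Definition tripartite_edges (n : nat) : {set {set 'I_(3 * n)}} :=
  [set e : {set 'I_(3 * n)} |
    (#|e| == 3) && [forall i : 'I_3, #|e :&: interval n i| == 1]].

Fact otripartite_subproof (n : nat) (e : {set 'I_(3 * n)}) :
  e \in tripartite_edges n -> e \subset setT /\ #|e| = 3.
Proof. by rewrite inE => /andP[/eqP -> _]; rewrite subsetT. Qed.

Definition otripartite (n : nat) : ohgraph 3 'I_(3 * n) :=
  OHGraph (@otripartite_subproof n).

(* A colouring is given on all sets of vertices, but only its values on the
   hyperedges of the complete hypergraph matter. *)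
Definition has_mono (k N : nat) (disp : Order.disp_t) (T : finOrderType disp)
    (col : {set 'I_N} -> bool) (b : bool) (H : ohgraph k T) : Prop :=
  exists S : ohgraph k 'I_N,
    [/\ osubgraph S (ocomplete k N),
        forall e, e \in edges S -> col e = b
      & oiso S H].

(* Blue is [true] and red is [false]. *)
Definition oarrows (k N : nat) (disp1 disp2 : Order.disp_t)
    (T1 : finOrderType disp1) (T2 : finOrderType disp2)
    (H : ohgraph k T1) (G : ohgraph k T2) : Prop :=
  forall col : {set 'I_N} -> bool, has_mono col true H \/ has_mono col false G.

Definition is_ordered_ramsey (k : nat) (disp1 disp2 : Order.disp_t)
    (T1 : finOrderType disp1) (T2 : finOrderType disp2)
    (H : ohgraph k T1) (G : ohgraph k T2) (N : nat) : Prop :=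
  oarrows N H G /\ forall M : nat, oarrows M H G -> N <= M.

(* Main.v *)
Require Import Defs.
From HB Require Import structures.
From mathcomp Require Import all_boot all_order all_algebra.
From mathcomp Require Import reals boolp sequences exp.
From mathcomp Require Import zify ring lra.

(* Cut the vertex set into [t] consecutive blocks and try to embed the [i]-th
   vertex of H into the [i]-th block, greedily from left to right, in blue. For
   j < k one keeps the graph [G_jk] of the pairs that are blue together with
   every embedded [a] such that [a j k] is a hyperedge of H, and requires every
   sub-rectangle of relative size rho to have density at least eps^r in [G_jk],
   where [r] counts those [a].  A vertex [x] destroying this property has a link
   that is red on a 1 - eps proportion of the pairs of [G_jk] in some large
   rectangle. If there are many such [x] in the block, a common rectangle trace
   is extracted by looking at only O(s / beta) vertices of the block [j], with
   beta a power of eps, and the red proportion 1 - eps gives a red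
   K_3^(3)(s) as soon as the blocks have size exp(O(s / beta + eps s^2)).
   Taking eps = s^(-delta) / 8 with delta = 1 / (1 + 3 d^2) balances both
   terms. *)

Set Implicit Arguments.
Unset Strict Implicit.
Unset Printing Implicit Defensive.

Import Order.TTheory GRing.Theory Num.Theory.
Local Open Scope ring_scope.

(** * Averaging and greedy selection *)

Lemma sum_indicator (R : nzSemiRingType) (I : finType) (A : {set I}) (p : pred I) :
  \sum_(i in A) (p i)%:R = #|[set i in A | p i]|%:R :> R.
Proof.
rewrite -natr_sum; congr (_%:R).
rewrite -sum1_card big_mkcond [RHS]big_mkcond /=.
by apply: eq_bigr => i _; rewrite inE; case: (i \in A); case: (p i).
Qed.

Lemma exists_ge_mean (R : realFieldType) (I : finType) (A : {set I}) (f : I -> R)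
    (c : R) :
  (0 < #|A|)%N -> #|A|%:R * c <= \sum_(i in A) f i ->
  exists2 i, i \in A & c <= f i.
Proof.
move=> A0 h; case: (boolP [exists i in A, c <= f i]) => [/exists_inP//|].
move=> /exists_inPn hn; suff : \sum_(i in A) f i < #|A|%:R * c by rewrite ltNge h.
rewrite mulr_natl -sumr_const.
have [i0 i0A] := card_gt0P A0.
rewrite (bigD1 i0) //= [X in _ < X](bigD1 i0) //=.
apply: ltr_leD; first by rewrite ltNge hn.
by apply: ler_sum => i /andP[iA _]; rewrite ltW // ltNge hn.
Qed.

(** Discarding an element whose value is at most the mean does not lower the mean. Induction on the
    number of elements to discard repeats this down to size [q]. *)
Lemma exists_large_subset (R : realFieldType) (I : finType) (A : {set I})
    (f : I -> R) (q : nat) :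
  (q <= #|A|)%N ->
  exists2 Q : {set I}, (Q \subset A) && (#|Q| == q) &
    q%:R * (\sum_(i in A) f i) <= #|A|%:R * \sum_(i in Q) f i.
Proof.
have [-> _|q0 qA] := posnP q.
  by exists set0; rewrite ?sub0set ?cards0 // mul0r big_set0 mulr0.
have [m Am] : exists m, #|A| = (q + m)%N.
  by exists (#|A| - q)%N; rewrite subnKC.
elim: m A {qA} Am => [|m IH] A Am.
  by exists A; rewrite ?subxx ?Am ?addn0 ?eqxx.
have A0 : (0 < #|A|)%N by rewrite Am addnS.
have [i iA] : exists2 i, i \in A &
    - ((#|A|%:R)^-1 * \sum_(j in A) f j) <= - f i.
  apply: exists_ge_mean => //; rewrite sumrN mulrN lerN2 mulrA divff ?mul1r //.
  by rewrite pnatr_eq0 -lt0n.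
rewrite lerN2 mulrC ler_pdivlMr ?ltr0n // => hi.
have cA : #|A :\ i| = (q + m)%N.
  by move: Am; rewrite (cardsD1 i) iA add1n addnS => -[].
have [Q /andP[QA Qq]] := IH _ cA.
have -> : \sum_(j in A :\ i) f j = \sum_(j in A) f j - f i.
  rewrite (bigD1 i iA) /= addrC addrK.
  by apply: eq_bigl => j; rewrite in_setD1 andbC.
rewrite cA => hQ; exists Q; first by rewrite Qq andbT (subset_trans QA) // subsetDl.
move: hQ hi; rewrite Am addnS -natr1.
have : 0 < (q + m)%:R :> R by rewrite ltr0n addn_gt0 q0.
have : 0 < q%:R :> R by rewrite ltr0n.
move: (q + m)%:R q%:R (\sum_(_ in _) _) (\sum_(_ in _) _) (f i) => M r S' S z r0 M0 h1 h2.
rewrite -(ler_pM2l M0).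
have : (M + 1) * (r * (S - z)) <= (M + 1) * (M * S') by rewrite ler_wpM2l //; lra.
have : r * (z * (M + 1)) <= r * S by rewrite ler_wpM2l // ltW.
by nra.
Qed.

(** The elements with value below [a] contribute at most [a * #|A|], half of the guaranteed sum. The
    remaining half comes from elements worth at most [b] each. *)
Lemma card_ge_half_mean (R : realFieldType) (I : finType) (A : {set I})
    (f : I -> R) (a b : R) :
  (forall i, i \in A -> f i <= b) -> 0 <= a ->
  2 * a * #|A|%:R <= \sum_(i in A) f i ->
  a * #|A|%:R <= b * #|[set i in A | a <= f i]|%:R.
Proof.
move=> fb a0 h.
suff : \sum_(i in A) f i <= a * #|A|%:R + b * #|[set i in A | a <= f i]|%:R by lra.
rewrite -sum_indicator mulr_sumr mulr_natr -sumr_const -big_split /=.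
apply: ler_sum => i iA; have := fb i iA.
case: (lerP a (f i)) => /= ; lra.
Qed.

Lemma greedy_common (R : realFieldType) (I J : finType) (W0 : {set I})
    (D : {set J}) (r : J -> I -> bool) (lam : R) (s : nat) :
  0 <= lam <= 1 -> (s <= #|W0|)%N ->
  (forall d, d \in D ->
     lam * #|W0|%:R + (1 - lam) * s%:R <= #|[set u in W0 | r d u]|%:R) ->
  exists2 W : {set I}, (W \subset W0) && (#|W| == s) &
    lam ^+ s * #|D|%:R <= #|[set d in D | [forall u in W, r d u]]|%:R.
Proof.
move=> /andP[lam0 lam1] sW hD.
suff : forall i, (i <= s)%N -> exists2 W : {set I}, (W \subset W0) && (#|W| == i) &
    lam ^+ i * #|D|%:R <= #|[set d in D | [forall u in W, r d u]]|%:R.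
  exact.
elim=> [_|i IH is_].
  exists set0; rewrite ?sub0set ?cards0 // expr0 mul1r ler_nat.
  apply: subset_leq_card; apply/subsetP => d dD; rewrite inE dD /=.
  by apply/forallP => u; rewrite inE.
have [W /andP[WW0 /eqP Wi] hW] := IH (ltnW is_).
set Di := [set d in D | _] in hW.
have cWD : #|W0 :\: W| = (#|W0| - i)%N by rewrite cardsD (setIidPr WW0) Wi.
have [u] : exists2 u, u \in W0 :\: W &
    lam * #|Di|%:R <= \sum_(d in Di) (r d u)%:R.
  apply: exists_ge_mean; first by rewrite cWD subn_gt0 (leq_trans is_).
  rewrite exchange_big /= mulrA mulr_natr -sumr_const.
  apply: ler_sum => d; rewrite inE => /andP[dD _].
  rewrite sum_indicator cWD natrB; last by rewrite (leq_trans (ltnW is_)).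
  have hd := hD d dD.
  have : #|[set u in W0 | r d u]|%:R <= #|[set u in W0 :\: W | r d u]|%:R + i%:R :> R.
    rewrite -natrD ler_nat -Wi.
    apply: leq_trans (leq_card_setU _ _); apply: subset_leq_card.
    by apply/subsetP => u; rewrite !inE => /andP[-> ->]; case: (u \in W).
  have : i%:R <= s%:R :> R by rewrite ler_nat ltnW.
  nra.
rewrite inE => /andP[uW uW0]; rewrite sum_indicator => hu.
exists (u |: W).
  by rewrite subUset sub1set uW0 WW0 cardsU1 uW Wi add1n eqxx.
rewrite exprS -mulrA; apply: le_trans (ler_wpM2l lam0 hW) _.
apply: le_trans hu _; rewrite ler_nat; apply: subset_leq_card.
apply/subsetP => d; rewrite !inE => /andP[/andP[-> /forallP h] rdu] /=.
apply/forallP => v; rewrite !inE; apply/implyP => /orP[/eqP ->//|vW].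
by have /implyP := h v; apply.
Qed.

(** A Kővári-Sós-Turán argument: many [y] have degree at least half the average, and a greedy choice
    of [s] common neighbours keeps a proportion [(sg / 4) ^+ s] of these [y]. *)
Lemma dense_biclique (R : realFieldType) (U : finType) (P Y : {set U})
    (D : {set U * U}) (sg : R) (s : nat) :
  0 < sg <= 1 -> (0 < s)%N -> D \subset setX P Y ->
  sg * #|P|%:R * #|Y|%:R <= #|D|%:R ->
  s%:R * (4 / sg) ^+ s.+1 <= #|P|%:R -> s%:R * (4 / sg) ^+ s.+1 <= #|Y|%:R ->
  exists A Z : {set U}, [/\ A \subset P, Z \subset Y, #|A| = s, #|Z| = s &
    forall x y, x \in A -> y \in Z -> (x, y) \in D].
Proof.
move=> /andP[sg0 sg1] s0 DPY hD hP hY.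
have s1 : 1 <= s%:R :> R by rewrite (ler_nat _ 1%N).
have sg4 : 1 <= 4 / sg by rewrite ler_pdivlMr //; lra.
have hP4 : 4 * s%:R <= sg * #|P|%:R.
  rewrite mulrC (mulrC sg) -ler_pdivrMr // -mulrA; apply: le_trans hP.
  by rewrite ler_wpM2l ?ler0n // ler_eXnr.
have P0 : (0 < #|P|)%N.
  have : 0 < sg * #|P|%:R by apply: lt_le_trans hP4; lra.
  by rewrite pmulr_rgt0 // ltr0n.
pose f y : R := \sum_(x in P) ((x, y) \in D)%:R.
have fE y : f y = #|[set x in P | (x, y) \in D]|%:R by rewrite /f sum_indicator.
pose Y' := [set y in Y | sg / 2 * #|P|%:R <= f y].
have : sg / 2 * #|P|%:R * #|Y|%:R <= #|P|%:R * #|Y'|%:R.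
  apply: card_ge_half_mean.
- move=> y _; rewrite fE ler_nat subset_leq_card //.
  by apply/subsetP => x; rewrite inE => /andP[].
- by rewrite mulr_ge0 // ?ler0n //; lra.
- rewrite exchange_big /= pair_big_dep /=.
  apply: le_trans (_ : #|D|%:R <= _); first by apply: le_trans hD; lra.
  rewrite -sum1_card natr_sum [X in X <= _]big_mkcond [X in _ <= X]big_mkcond /=.
  apply: ler_sum => -[x y] _ /=; case: (boolP ((x, y) \in D)) => [xyD|_].
    by have /subsetP/(_ _ xyD) := DPY; rewrite in_setX => /andP[-> ->].
  by case: ifP.
move=> hY'; have {}hY' : sg / 2 * #|Y|%:R <= #|Y'|%:R.
  rewrite -(@ler_pM2l _ #|P|%:R) ?ltr0n //; apply: le_trans hY'; lra.
(* Passing from [sg / 2] to [sg / 4] leaves room for the slack of the greedy choice, since [s] is at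
   most [sg / 4 * #|P|] by [hP4]. *)
have [||y yY'|A /andP[AP /eqP As] hA] :=
  @greedy_common R U U P Y' (fun y x => (x, y) \in D) (sg / 4) s.
- by apply/andP; split; lra.
- rewrite -(ler_nat R); have : sg * #|P|%:R <= 1 * #|P|%:R by rewrite ler_wpM2r ?ler0n.
  lra.
- move: yY'; rewrite inE fE => /andP[_]; apply: le_trans.
  have : 0 <= sg / 4 * s%:R by rewrite mulr_ge0 ?ler0n //; lra.
  lra.
set Z0 := [set d in Y' | _] in hA.
have : (s <= #|Z0|)%N.
  rewrite -(ler_nat R); apply: le_trans hA.
  have h4 : 0 < (sg / 4) ^+ s by rewrite exprn_gt0 //; lra.
  apply: (@le_trans _ _ ((sg / 4) ^+ s.+1 * #|Y|%:R)); last first.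
    rewrite exprSr -mulrA ler_pM2l //; apply: le_trans hY'.
    by rewrite ler_wpM2r ?ler0n //; lra.
  apply: le_trans (ler_wpM2l _ hY); last by rewrite exprn_ge0 //; lra.
  rewrite mulrCA -exprMn -invf_div mulVf ?expr1n ?mulr1 //.
  by rewrite mulf_neq0 ?invr_eq0 ?gt_eqF.
case/(exists_large_subset (fun=> 0 : R)) => Z /andP[ZZ0 /eqP Zs] _.
exists A, Z; split => //.
  by apply: subset_trans ZZ0 _; apply/subsetP => y; rewrite !inE => /andP[/andP[]].
move=> x y xA /(subsetP ZZ0); rewrite inE => /andP[_ /forallP/(_ x)].
by rewrite xA.
Qed.

(** * Red tripartite subhypergraphs from sparse links *)

Definition edge_sum (R : nzSemiRingType) (U : finType) (G : U -> U -> bool)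
    (X Y : {set U}) : R :=
  \sum_(u in X) \sum_(y in Y) (G u y)%:R.

Definition red_tripartite (U : finType) (bl : U -> U -> U -> bool) (s : nat)
    (V1 V2 V3 : {set U}) : Prop :=
  exists A B C : {set U},
    [/\ A \subset V1, B \subset V2, C \subset V3,
        [/\ #|A| = s, #|B| = s & #|C| = s] &
        forall x y z, x \in A -> y \in B -> z \in C -> ~~ bl x y z].

(** The weights [T - a] still have total at least [a * #|B| * #|V|], so one of the rectangles on
    which both keys are constant receives at least the average share. The first term on the left
    then expresses density inside this rectangle, and the second will force it to be large. *)
Lemma rectangle_pigeonhole (R : realFieldType) (I J K L : finType)
    (B : {set I}) (V : {set J}) (k : I -> K) (l : J -> L)
    (SK : {set K}) (SL : {set L}) (T : I * J -> R) (a : R) :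
  (0 < #|SK|)%N -> (0 < #|SL|)%N ->
  (forall x, x \in B -> k x \in SK) -> (forall y, y \in V -> l y \in SL) ->
  2 * a * #|B|%:R * #|V|%:R <= \sum_(p in setX B V) T p ->
  exists s t, [/\ s \in SK, t \in SL &
    let P := [set x in B | k x == s] in let Y := [set y in V | l y == t] in
    a * (#|P|%:R * #|Y|%:R + #|B|%:R * #|V|%:R / (#|SK| * #|SL|)%:R) <=
      \sum_(p in setX P Y) T p].
Proof.
move=> K0 L0 kS lS hT.
pose key (p : I * J) := (k p.1, l p.2).
have sum_const (P : {set I}) (Y : {set J}) :
    \sum_(p in setX P Y) (T p - a) = \sum_(p in setX P Y) T p - a * (#|P|%:R * #|Y|%:R).
  by rewrite sumrB sumr_const cardsX -[a *+ _]mulr_natr natrM.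
have := @exists_ge_mean R _ (setX SK SL)
  (fun q => \sum_(p in setX B V | key p == q) (T p - a))
  (a * (#|B|%:R * #|V|%:R) / #|setX SK SL|%:R).
have c0 : (0 < #|setX SK SL|)%N by rewrite cardsX muln_gt0 K0.
case=> //.
  rewrite mulrC divfK; last by rewrite pnatr_eq0 -lt0n.
  rewrite -partition_big; first by rewrite sum_const; lra.
  move=> [x y]; rewrite !in_setX => /andP[xB yV] /=.
  by rewrite kS ?lS.
move=> [s t] + h; rewrite in_setX => /andP[sK tL].
exists s, t; split=> //; move: h; rewrite cardsX /=.
have -> : \sum_(p in setX B V | key p == (s, t)) (T p - a) =
    \sum_(p in setX [set x in B | k x == s] [set y in V | l y == t]) (T p - a).
  apply: eq_bigl => -[x y]; rewrite !in_setX !inE /= xpair_eqE.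
  by rewrite andbACA.
rewrite sum_const; lra.
Qed.

(** First the middle class [W] is chosen greedily inside [W0], red to a proportion
    [(1 - 4 * eps) ^+ s] of the pairs in [D]; then a biclique among these pairs gives the outer
    classes. Weakening [1 - 2 * eps] to [1 - 4 * eps] covers the greedy slack because
    [2 * s <= #|W0|]. *)
Lemma dense_pairs_red_tripartite (R : realFieldType) (U : finType)
    (bl : U -> U -> U -> bool) (P Y W0 : {set U}) (D : {set U * U})
    (eps be : R) (s : nat) :
  0 < eps <= 8^-1 -> 0 < be <= 1 -> (0 < s)%N ->
  D \subset setX P Y -> be * #|P|%:R * #|Y|%:R <= #|D|%:R ->
  2 * s%:R <= #|W0|%:R :> R ->
  (forall p, p \in D ->
     (1 - 2 * eps) * #|W0|%:R <= #|[set u in W0 | ~~ bl p.1 u p.2]|%:R) ->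
  s%:R * (4 / (be * (1 - 4 * eps) ^+ s)) ^+ s.+1 <= #|P|%:R ->
  s%:R * (4 / (be * (1 - 4 * eps) ^+ s)) ^+ s.+1 <= #|Y|%:R ->
  red_tripartite bl s P W0 Y.
Proof.
move=> /andP[e0 e1] /andP[b0 b1] s0 DPY hD hW hred hP hY.
have l0 : 0 < 1 - 4 * eps by lra.
have l1 : 1 - 4 * eps <= 1 by lra.
have [|||W /andP[WW0 /eqP Ws] hW'] := @greedy_common R U (U * U)%type W0 D
    (fun p u => ~~ bl p.1 u p.2) (1 - 4 * eps) s.
- by rewrite ltW.
- by rewrite -(ler_nat R); have : 0 <= s%:R :> R by []; lra.
- by move=> p /hred; apply: le_trans; nra.
set D' := [set p in D | _] in hW'.
have [||||||A [Z [AP ZY As Zs hAZ]]] := @dense_biclique R U P Y D'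
    (be * (1 - 4 * eps) ^+ s) s.
- have p0 : 0 < (1 - 4 * eps) ^+ s by rewrite exprn_gt0.
  have p1 : (1 - 4 * eps) ^+ s <= 1 by rewrite exprn_ile1 // ltW.
  by rewrite mulr_gt0 //= mulr_ile1 // ltW.
- by [].
- by apply: subset_trans DPY; apply/subsetP => p; rewrite inE => /andP[].
- apply: le_trans hW'; rewrite -!mulrA mulrCA ler_wpM2l ?exprn_ge0 ?(ltW l0) //.
  by rewrite mulrA.
- by [].
- by [].
exists A, W, Z; split=> // x u z xA uW zZ.
have := hAZ _ _ xA zZ; rewrite inE => /andP[_ /forallP/(_ u)].
by rewrite uW.
Qed.

(* The links of different [x] are sparse on different rectangles [X x], [Y x].
   Only the trace of [X x] on a set [Q] of [q] vertices matters, so one of the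
   [4 ^ q] classes (trace of [X x], trace of the [G]-neighbourhood of [y])
   carries a dense set of pairs [(x, y)] that see almost only red on the common
   trace [W0]. Measuring density relative to the class of [y], rather than to
   [V2], is what keeps the loss [4 ^ q] out of the [s]-th power. *)
Lemma sparse_links_red_tripartite (R : realFieldType) (U : finType)
    (bl : U -> U -> U -> bool) (G : U -> U -> bool) (B V1 V2 : {set U})
    (X Y : U -> {set U}) (n q s : nat) (eps rho gam be : R) :
  0 < eps <= 8^-1 -> 0 < rho -> 0 <= gam -> 0 < be <= 1 -> 4 * be <= gam * rho ^+ 2 ->
  (0 < s)%N -> (q <= n)%N -> 2 * s%:R <= be * q%:R ->
  #|V1| = n -> #|V2| = n -> rho * n%:R <= #|B|%:R ->
  (forall x, x \in B ->
    [/\ X x \subset V1, Y x \subset V2, rho * n%:R <= #|X x|%:R,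
        rho * n%:R <= #|Y x|%:R &
        gam * #|X x|%:R * #|Y x|%:R <= edge_sum R G (X x) (Y x) /\
        edge_sum R (fun u y => G u y && bl x u y) (X x) (Y x) <=
          eps * gam * #|X x|%:R * #|Y x|%:R]) ->
  4 ^+ q * (s%:R * (4 / (be * (1 - 4 * eps) ^+ s)) ^+ s.+1) <= be * rho * n%:R ->
  rho <= 1 ->
  red_tripartite bl s B V1 V2.
Proof.
move=> /andP[e0 e1] r0 g0 /andP[b0 b1] hbe s0 qn hq V1n V2n hB hX hn r1.
set N0 := s%:R * _ in hn.
have s0R : 0 < s%:R :> R by rewrite ltr0n.
have q0R : 0 < q%:R :> R.
  by rewrite -(pmulr_rgt0 _ b0); apply: lt_le_trans hq; rewrite mulr_gt0.
have n0R : 0 < n%:R :> R by apply: lt_le_trans q0R _; rewrite ler_nat.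
have B0R : 0 < #|B|%:R :> R by apply: lt_le_trans hB; rewrite mulr_gt0.
(* The penalty [1 / (2 eps)] makes a positive total weight force a blue
   proportion below [2 eps]. *)
pose h x u y : R := (G u y)%:R - (G u y && bl x u y)%:R / (2 * eps).
pose F x u y : R := if (u \in X x) && (y \in Y x) then h x u y else 0.
(* The edges weigh at least [gam * #|X x| * #|Y x|], and the penalty takes away at most half of it.
   The sizes of [X x], [Y x] and the bound on [4 * be] do the rest. *)
have hF x : x \in B ->
    2 * be * n%:R * n%:R <= \sum_(u in V1) \sum_(y in V2) F x u y.
  move=> xB; have [XV YV cX cY [hG hbl]] := hX x xB.
  have -> : \sum_(u in V1) \sum_(y in V2) F x u y =
      edge_sum R G (X x) (Y x)
      - edge_sum R (fun u y => G u y && bl x u y) (X x) (Y x) / (2 * eps).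
    rewrite /edge_sum mulr_suml -sumrB (big_setID (X x)) /= (setIidPr XV).
    rewrite [X in _ + X]big1 ?addr0 => [|u]; last first.
      rewrite inE => /andP[uX _]; apply: big1 => y _.
      by rewrite /F (negPf uX).
    apply: eq_bigr => u uX; rewrite mulr_suml -sumrB.
    rewrite (big_setID (Y x)) /= (setIidPr YV).
    rewrite [X in _ + X]big1 ?addr0 => [|y]; last first.
      by rewrite inE => /andP[yY _]; rewrite /F (negPf yY) andbF.
    by apply: eq_bigr => y yY; rewrite /F uX yY.
  have : edge_sum R (fun u y => G u y && bl x u y) (X x) (Y x) / (2 * eps) <=
      gam * #|X x|%:R * #|Y x|%:R / 2.
    rewrite ler_pdivrMr; last lra.
    by apply: le_trans hbl _; lra.
  have : (rho * n%:R) * (rho * n%:R) <= #|X x|%:R * #|Y x|%:R.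
    by rewrite ler_pM // mulr_ge0 ?ltW.
  move/(ler_wpM2l g0) => h1 h2.
  have : 4 * be * (n%:R * n%:R) <= gam * rho ^+ 2 * (n%:R * n%:R).
    by rewrite ler_wpM2r // mulr_ge0 // ltW.
  rewrite expr2; lra.
have qV1 : (q <= #|V1|)%N by rewrite V1n.
(* Averaging over [V1] yields a sample [Q] of [q] vertices that retains its share [q / n] of the
   total weight. *)
have [Q /andP[QV /eqP Qq]] := exists_large_subset
  (fun u => \sum_(p in setX B V2) F p.1 u p.2) qV1.
rewrite [X in _ * X <= _]exchange_big [X in _ <= _ * X]exchange_big /= V1n => hQ.
have {}hQ : 2 * (be * q%:R) * #|B|%:R * #|V2|%:R <=
    \sum_(p in setX B V2) \sum_(u in Q) F p.1 u p.2.
  rewrite -(ler_pM2l n0R); apply: le_trans hQ; rewrite V2n.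
  apply: (@le_trans _ _ (q%:R * (#|B|%:R * (2 * be * n%:R * n%:R)))); first lra.
  rewrite ler_pM2l // mulr_natl -sumr_const.
  rewrite (eq_bigl (fun p => (p.1 \in B) && (p.2 \in V2))); last first.
    by move=> [x y]; rewrite in_setX.
  rewrite -(pair_big (mem B) (mem V2) (fun x y => \sum_(u in V1) F x u y)) /=.
  by apply: ler_sum => x xB; rewrite exchange_big hF.
have pQ : (0 < #|powerset Q|)%N by rewrite card_powerset expn_gt0.
have [x xB|y yV|S [tau [SQ _]]] := rectangle_pigeonhole (k := fun x => X x :&: Q)
  (l := fun y => [set u in Q | G u y]) pQ pQ _ _ hQ.
- by rewrite inE subsetIr.
- by rewrite inE; apply/subsetP => u; rewrite inE => /andP[].
set P := [set x in B | _]; set Z := [set y in V2 | _] => /=.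
rewrite card_powerset Qq => hPZ.
(* For every pair of the class, the [u] in [Q] with [u \in X x] and [G u y] are exactly those of
   [W0], whichever [x] and [y] are taken. *)
pose W0 := S :&: tau.
pose good p := (1 - 2 * eps) * #|W0|%:R <= #|[set u in W0 | ~~ bl p.1 u p.2]|%:R.
pose D := [set p in setX P Z | good p].
(* A pair that is not good has weight at most 0 by the choice of the penalty; a good one has weight
   at most [#|W0|]. *)
have hT : \sum_(p in setX P Z) \sum_(u in Q) F p.1 u p.2 <= #|W0|%:R * #|D|%:R.
  have -> : #|D|%:R = \sum_(p in setX P Z) (good p)%:R :> R by rewrite sum_indicator.
  rewrite mulr_sumr; apply: ler_sum => -[x y].
  rewrite in_setX !inE /= => /andP[/andP[xB /eqP xS] /andP[yV /eqP ytau]].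
  case: (boolP (y \in Y x)) => [yY|yY]; last first.
    by rewrite big1 ?mulr_ge0 // => u _; rewrite /F (negPf yY) andbF.
  have -> : \sum_(u in Q) F x u y =
      #|W0|%:R - #|[set u in W0 | bl x u y]|%:R / (2 * eps).
    have WQ : W0 \subset Q.
      by apply/subsetP => u; rewrite !inE -xS !inE => /andP[/andP[_ ->]].
    rewrite (big_setID W0) /= (setIidPr WQ) [X in _ + X]big1 ?addr0; last first.
      move=> u; rewrite !inE -xS -ytau !inE => /andP[uW uQ].
      move: uW; rewrite uQ /= andbT /F => uW.
      case: ifP => // /andP[uX _]; move: uW; rewrite uX /= /h => /negPf ->.
      by rewrite mul0r subr0.
    have -> : #|[set u in W0 | bl x u y]|%:R =
        \sum_(u in W0) (bl x u y)%:R :> R by rewrite sum_indicator.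
    rewrite mulr_suml -sumr_const -sumrB.
    apply: eq_bigr => u; rewrite !inE -xS -ytau !inE.
    by move=> /andP[/andP[uX _] /andP[_ Gu]]; rewrite /F uX yY /h Gu.
  have cW : #|[set u in W0 | bl x u y]|%:R =
      #|W0|%:R - #|[set u in W0 | ~~ bl x u y]|%:R :> R.
    rewrite -(cardsID [set u | bl x u y] W0) natrD.
    have -> : W0 :&: [set u | bl x u y] = [set u in W0 | bl x u y].
      by apply/setP => u; rewrite !inE.
    have -> : W0 :\: [set u | bl x u y] = [set u in W0 | ~~ bl x u y].
      by apply/setP => u; rewrite !inE andbC.
    by rewrite addrK.
  case: (boolP (good (x, y))) => /=.
    by rewrite mulr1 gerDl oppr_le0 divr_ge0 // mulr_ge0 // ltW.
  rewrite -ltNge /= mulr0 subr_le0 ler_pdivlMr; last lra.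
  rewrite cW; lra.
pose M : R := (2 ^ q * 2 ^ q)%:R.
have ME : M = 4 ^+ q by rewrite /M -expnMn natrX.
have M0 : 0 < M by rewrite ME exprn_gt0.
have {}hT : be * q%:R * (#|P|%:R * #|Z|%:R + #|B|%:R * #|V2|%:R / M) <=
    #|W0|%:R * #|D|%:R by apply: le_trans hPZ hT.
have DPZ : #|D|%:R <= #|P|%:R * #|Z|%:R :> R.
  rewrite -natrM -cardsX ler_nat subset_leq_card //.
  by apply/subsetP => p; rewrite inE => /andP[].
have W0Q : W0 \subset Q by apply: subset_trans (subsetIl _ _) _; rewrite inE in SQ.
have W0q : #|W0|%:R <= q%:R :> R by rewrite -Qq ler_nat subset_leq_card.
have PB : #|P|%:R <= #|B|%:R :> R.
  by rewrite ler_nat subset_leq_card //; apply/subsetP => x; rewrite inE => /andP[].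
have ZV : #|Z|%:R <= n%:R :> R.
  by rewrite -V2n ler_nat subset_leq_card //; apply/subsetP => x; rewrite inE => /andP[].
have WD0 : 0 <= #|W0|%:R * #|D|%:R :> R by rewrite mulr_ge0.
have D0 : 0 <= #|D|%:R :> R by [].
have bq0 : 0 < be * q%:R by rewrite mulr_gt0.
have BM0 : 0 < #|B|%:R * n%:R / M by rewrite divr_gt0 // mulr_gt0.
rewrite V2n in hT.
clearbody M.
set z : R := #|B|%:R * n%:R / M in BM0 hT.
(* From here [hT] is read in three ways: bounding [#|W0|] by [q] makes [D] dense, bounding [#|D|] by
   [#|P| * #|Z|] makes [W0] large, and using both bounds makes the rectangle large. *)
have hD : be * #|P|%:R * #|Z|%:R <= #|D|%:R.
  rewrite -(ler_pM2l q0R).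
  have : #|W0|%:R * #|D|%:R <= q%:R * #|D|%:R :> R by rewrite ler_wpM2r.
  have := mulr_ge0 (ltW bq0) (ltW BM0); lra.
have PZ0 : 0 < #|P|%:R * #|Z|%:R :> R.
  have : 0 < #|W0|%:R * #|D|%:R :> R.
    apply: lt_le_trans hT; rewrite mulr_gt0 //; apply: ltr_wpDl => //.
    by rewrite mulr_ge0.
  move/lt_le_trans/(_ (ler_wpM2l (ler0n R #|W0|) DPZ)).
  case: (ltrP 0 (#|P|%:R * #|Z|%:R : R)) => // h3.
  by rewrite ltNge mulr_ge0_le0.
have hW0 : be * q%:R <= #|W0|%:R.
  rewrite -(ler_pM2r PZ0); have := ler_wpM2l (ler0n R #|W0|) DPZ.
  have := mulr_ge0 (ltW bq0) (ltW BM0); lra.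
have hPZn : be * z <= #|P|%:R * #|Z|%:R.
  rewrite -(ler_pM2l q0R).
  have : #|W0|%:R * #|D|%:R <= q%:R * (#|P|%:R * #|Z|%:R) :> R by rewrite ler_pM.
  have := mulr_ge0 (ltW bq0) (ltW PZ0); lra.
(* The lower bound on the product [#|P| * #|Z|] bounds each factor, as the other one is at most [n],
   respectively [#|B|]. *)
have hP : N0 <= #|P|%:R.
  apply: (@le_trans _ _ (be * rho * n%:R / M)).
    by rewrite ler_pdivlMr // mulrC ME.
  apply: (@le_trans _ _ (be * (#|B|%:R / M))).
    by rewrite -!mulrA ler_pM2l // !mulrA ler_pM2r ?invr_gt0.
  rewrite -(ler_pM2r n0R).
  have := ler_wpM2l (ler0n R #|P|) ZV; move: hPZn; rewrite /z; lra.
have hZ : N0 <= #|Z|%:R.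
  apply: (@le_trans _ _ (be * rho * n%:R / M)).
    by rewrite ler_pdivlMr // mulrC ME.
  apply: (@le_trans _ _ (be * (n%:R / M))).
    by rewrite -!mulrA ler_pM2l // ler_piMl // divr_ge0 // ltW.
  rewrite -(ler_pM2l B0R).
  have := ler_wpM2r (ler0n R #|Z|) PB; move: hPZn; rewrite /z; lra.
have [||||||p|||A [W [C [AP WW CZ cards hred]]]] :=
  @dense_pairs_red_tripartite R U bl P Z W0 D eps be s.
- by rewrite e0.
- by rewrite b0.
- by [].
- by apply/subsetP => p; rewrite inE => /andP[].
- exact: hD.
- by apply: le_trans hq hW0.
- by rewrite inE => /andP[_].
- exact: hP.
- exact: hZ.
exists A, W, C; split => //.
- by apply: subset_trans AP _; apply/subsetP => x; rewrite inE => /andP[].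
- exact: subset_trans WW (subset_trans W0Q QV).
- by apply: subset_trans CZ _; apply/subsetP => x; rewrite inE => /andP[].
Qed.

(** * Greedy embedding of the blue hypergraph *)

Lemma card_bigcup_le (R : realFieldType) (I T : finType) (S : {set I})
    (F : I -> {set T}) (c : R) :
  (forall i, i \in S -> #|F i|%:R <= c) ->
  #|\bigcup_(i in S) F i|%:R <= #|S|%:R * c.
Proof.
move=> hF; rewrite mulr_natl -[c *+ _]sumr_const.
pose K (A : {set T}) (x : R) := #|A|%:R <= x.
apply: (@big_ind2 _ _ K); rewrite /K ?cards0 // => A x B y hA hB.
by apply: le_trans (lerD hA hB); rewrite -natrD ler_nat leq_card_setU.
Qed.

Lemma edge_sum_mono (R : realFieldType) (U : finType) (G G' : U -> U -> bool)
    (X Y : {set U}) :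
  (forall u y, G u y -> G' u y) -> edge_sum R G X Y <= edge_sum R G' X Y.
Proof.
move=> h; apply: ler_sum => u _; apply: ler_sum => y _; rewrite ler_nat.
by case: (boolP (G u y)) => // /h ->.
Qed.

Lemma edge_sum_true (R : realFieldType) (U : finType) (G : U -> U -> bool)
    (X Y : {set U}) :
  (forall u y, G u y) -> edge_sum R G X Y = #|X|%:R * #|Y|%:R.
Proof.
move=> h; rewrite /edge_sum mulr_natl -sumr_const; apply: eq_bigr => u _.
by rewrite -sumr_const; apply: eq_bigr => y _; rewrite h.
Qed.

(** At each step at most [d] bad sets of size at most [rho * n] have to be avoided inside a
    candidate set of size at least [eps ^+ d * n]. The relation [rho * d.+1 = eps ^+ d] is exactly
    what leaves a vertex over. *)
Lemma greedy_embedding (R : realFieldType) (U : finType)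
    (bl : U -> U -> U -> bool) (t n d s q : nat) (V : 'I_t -> {set U})
    (E : 'I_t -> 'I_t -> 'I_t -> bool) (eps rho be : R) (x0 : U) :
  0 < eps <= 8^-1 -> rho * d.+1%:R = eps ^+ d -> 4 * be = eps ^+ d * rho ^+ 2 ->
  (0 < s)%N -> (q <= n)%N -> 2 * s%:R <= be * q%:R ->
  4 ^+ q * (s%:R * (4 / (be * (1 - 4 * eps) ^+ s)) ^+ s.+1) <= be * rho * n%:R ->
  (forall a b k, E a b k -> (a < b < k)%N) ->
  (forall k, (#|[set p : 'I_t * 'I_t | E p.1 p.2 k]| <= d)%N) ->
  (forall i, (#|[set p : 'I_t * 'I_t | E p.1 i p.2]| +
              #|[set p : 'I_t * 'I_t | E i p.1 p.2]| <= d)%N) ->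
  (forall i, #|V i| = n) ->
  (forall i j k : 'I_t, (i < j < k)%N -> ~ red_tripartite bl s (V i) (V j) (V k)) ->
  exists x : 'I_t -> U, (forall i, x i \in V i) /\
    forall a b k, E a b k -> bl (x a) (x b) (x k).
Proof.
move=> eps01 hrho hbe s0 qn hq hn hE hdegl hdegm hV hred.
have /andP[e0 e8] := eps01.
have e1 : eps <= 1 by lra.
have d0R : 0 < d.+1%:R :> R by rewrite ltr0n.
have ed0 : 0 < eps ^+ d by rewrite exprn_gt0.
have ed1 : eps ^+ d <= 1 by rewrite exprn_ile1 // ltW.
have r0 : 0 < rho by rewrite -(pmulr_lgt0 _ d0R) hrho.
have d1R : 1 <= d.+1%:R :> R by rewrite (ler_nat _ 1%N).
have r1 : rho <= eps ^+ d by rewrite -hrho ler_pMr.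
have rle1 : rho <= 1 by apply: le_trans r1 ed1.
have be0 : 0 < be.
  by rewrite -(@pmulr_rgt0 _ 4) // hbe mulr_gt0 // exprn_gt0.
have be1 : be <= 1.
  have : eps ^+ d * rho ^+ 2 <= 1.
    by rewrite mulr_ile1 ?exprn_ile1 ?exprn_ge0 // ltW.
  lra.
have n0R : 0 < n%:R :> R.
  have : 0 < q%:R :> R.
    by rewrite -(pmulr_rgt0 _ be0); apply: lt_le_trans hq; rewrite mulr_gt0 ?ltr0n.
  by move/lt_le_trans; apply; rewrite ler_nat.
(* [r] and [c] count the constraints already put on the pair [(j, k)] and on the candidates of [k].
   Both stay at most [d], so the powers of [eps] never fall below [eps ^+ d]. In [c] it suffices to
   test [p.2 < i], since [p.1] precedes [p.2] in an edge. *)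
pose r i (j k : 'I_t) := #|[set a : 'I_t | (a < i)%N && E a j k]|.
pose c i (k : 'I_t) := #|[set p : 'I_t * 'I_t | (p.2 < i)%N && E p.1 p.2 k]|.
pose G i (x : 'I_t -> U) (j k : 'I_t) u w :=
  [forall a : 'I_t, (a < i)%N && E a j k ==> bl (x a) u w].
pose A i (x : 'I_t -> U) (k : 'I_t) := [set w in V k |
  [forall p : 'I_t * 'I_t, (p.2 < i)%N && E p.1 p.2 k ==> bl (x p.1) (x p.2) w]].
have rd i j k : (r i j k <= d)%N.
  apply: leq_trans (leq_trans (leq_addr _ _) (hdegm j)).
  rewrite /r -(card_imset _ (f := fun a => (a, k))) => [|a b []//].
  apply: subset_leq_card; apply/subsetP => p /imsetP[a].
  by rewrite inE => /andP[_ Ea] ->; rewrite inE.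
have cd i k : (c i k <= d)%N.
  apply: leq_trans (hdegl k); apply: subset_leq_card; apply/subsetP => p.
  by rewrite !inE => /andP[].
(* After embedding the vertices below [i], [A i x k] is the candidate set of [k]
   and [G i x j k] the set of pairs still allowed for [(j, k)]. *)
pose Inv i x := [/\ forall a : 'I_t, (a < i)%N -> x a \in V a,
  forall j k : 'I_t, (i <= j)%N -> (j < k)%N -> forall X Y : {set U},
    X \subset V j -> Y \subset V k -> rho * n%:R <= #|X|%:R ->
    rho * n%:R <= #|Y|%:R ->
    eps ^+ r i j k * #|X|%:R * #|Y|%:R <= edge_sum R (G i x j k) X Y,
  forall k : 'I_t, (i <= k)%N -> eps ^+ c i k * n%:R <= #|A i x k|%:R &
  forall a b k : 'I_t, (k < i)%N -> E a b k -> bl (x a) (x b) (x k)].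
suff : forall i, (i <= t)%N -> exists x, Inv i x.
  move/(_ t (leqnn t)) => [x [xV _ _ xE]]; exists x; split=> [i|a b k].
    exact: xV.
  exact: xE.
elim=> [_|i IH it].
  exists (fun=> x0); split=> // [j k _ _ X Y _ _ _ _|k _].
    have -> : r 0 j k = 0%N by apply: eq_card0 => a; rewrite inE.
    rewrite edge_sum_true ?expr0 ?mul1r // => u w.
    by apply/forallP => a.
  have -> : c 0 k = 0%N by apply: eq_card0 => a; rewrite inE.
  rewrite expr0 mul1r ler_nat -(hV k) subset_leq_card //.
  by apply/subsetP => w wV; rewrite inE wV; apply/forallP => p.
have [x [xV xG xA xE]] := IH (ltnW it).
pose o := Ordinal it.
(* A choice of [z] can fail in two ways: [BadA] collects those that shrink the candidates of a later
   vertex too much, [BadB] those whose link is too sparse on some large rectangle. *)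
pose BadA k := [set z in A i x o |
  #|[set w in A i x k | G i x o k z w]|%:R < eps ^+ r i o k * #|A i x k|%:R].
pose sparse (p : 'I_t * 'I_t) z (XY : {set U} * {set U}) :=
  [&& XY.1 \subset V p.1, XY.2 \subset V p.2, rho * n%:R <= #|XY.1|%:R,
    rho * n%:R <= #|XY.2|%:R &
    edge_sum R (fun u w => G i x p.1 p.2 u w && bl z u w) XY.1 XY.2 <
      eps ^+ (r i p.1 p.2).+1 * #|XY.1|%:R * #|XY.2|%:R].
pose BadB p := [set z in V o | [exists XY, sparse p z XY]].
have Alarge (k : 'I_t) : (i <= k)%N -> eps ^+ d * n%:R <= #|A i x k|%:R.
  move=> ik; apply: le_trans (xA k ik); rewrite ler_pM2r //.
  by rewrite ler_wiXn2l // ltW.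
have ArV k : A i x k \subset V k by apply/subsetP => w; rewrite inE => /andP[].
have rhoA (k : 'I_t) : (i <= k)%N -> rho * n%:R <= #|A i x k|%:R.
  by move=> ik; apply: le_trans (Alarge k ik); rewrite ler_pM2r.
(* A larger [BadA k] would span with [A i x k] a rectangle that violates the density invariant [xG]
   for the pair [(o, k)]. *)
have hBadA (k : 'I_t) : (i < k)%N -> #|BadA k|%:R <= rho * n%:R.
  move=> ik; rewrite leNgt; apply/negP => hB.
  have BV : BadA k \subset V o.
    by apply: subset_trans (ArV o); apply/subsetP => z; rewrite inE => /andP[].
  have := xG o k (leqnn _) ik _ _ BV (ArV k) (ltW hB) (rhoA k (ltnW ik)).
  apply/negP; rewrite -ltNge /edge_sum.
  rewrite mulrAC mulrC mulr_natl -sumr_const.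
  have /card_gt0P[z0 z0B] : (0 < #|BadA k|)%N.
    by rewrite -(ltr0n R); apply: lt_trans hB; rewrite mulr_gt0.
  have hz z : z \in BadA k ->
      \sum_(w in A i x k) (G i x o k z w)%:R < eps ^+ r i o k * #|A i x k|%:R.
    by rewrite inE sum_indicator => /andP[].
  rewrite (bigD1 z0) //= [X in _ < X](bigD1 z0) //=.
  apply: ltr_leD; first exact: hz.
  by apply: ler_sum => z /andP[/hz /ltW].
(* A larger [BadB p] would provide enough sparse links for a red tripartite subhypergraph, excluded
   by [hred]. *)
have hBadB p : E o p.1 p.2 -> #|BadB p|%:R <= rho * n%:R.
  move=> Ep; rewrite leNgt; apply/negP => /ltW hB.
  have /andP[op1 p12] := hE _ _ _ Ep.
  pose XY z := odflt (set0, set0) [pick XY | sparse p z XY].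
  have hXY z : z \in BadB p -> sparse p z (XY z).
    rewrite inE /XY => /andP[_ /existsP[XY0 h0]].
    by case: pickP => [//|/(_ XY0)]; rewrite h0.
  have [|||||||||||z zB|||A1 [B1 [C1 [AB BV CV cards hr]]]] :=
    @sparse_links_red_tripartite R U bl (G i x p.1 p.2) (BadB p) (V p.1) (V p.2)
      (fun z => (XY z).1) (fun z => (XY z).2) n q s eps rho
      (eps ^+ r i p.1 p.2) be.
  - by [].
  - by [].
  - by rewrite exprn_ge0 // ltW.
  - by rewrite be0.
  - by rewrite hbe ler_wpM2r ?sqr_ge0 // ler_wiXn2l // ltW.
  - by [].
  - by [].
  - by [].
  - by [].
  - by [].
  - by [].
  - have /and5P[h1 h2 h3 h4 /ltW h5] := hXY _ zB; split=> //; split.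
      exact: xG (ltnW op1) p12 _ _ h1 h2 h3 h4.
    by rewrite -exprS.
  - by [].
  - by [].
  apply: (hred o p.1 p.2); first by rewrite op1.
  exists A1, B1, C1; split=> //; apply: subset_trans AB _.
  by apply/subsetP => z; rewrite inE => /andP[].
(* Only edges with [o] in the middle or in front create constraints at this step, and [hdegm] bounds
   their number by [d]. *)
pose Bad := \bigcup_(p in [set p | E p.1 o p.2]) BadA p.2 :|:
            \bigcup_(p in [set p | E o p.1 p.2]) BadB p.
have [z zA zBad] : exists2 z, z \in A i x o & z \notin Bad.
  apply/subsetPn/negP => /subset_leq_card; rewrite leqNgt => /negP; apply.
  rewrite -(ltr_nat R).
  apply: lt_le_trans (Alarge o (leqnn _)).
  have [hA1 hB1] := (card_bigcup_le (S := [set p | E p.1 o p.2]) (F := fun p => BadA p.2)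
    (c := rho * n%:R), card_bigcup_le (S := [set p | E o p.1 p.2]) (F := BadB)
    (c := rho * n%:R)).
  apply: (@le_lt_trans _ _ (d%:R * (rho * n%:R))).
    apply: le_trans (_ : _ <= (#|[set p : 'I_t * 'I_t | E p.1 o p.2]| +
              #|[set p : 'I_t * 'I_t | E o p.1 p.2]|)%:R * (rho * n%:R)) _; last first.
      by rewrite ler_wpM2r ?ler_nat ?mulr_ge0 // ltW.
    rewrite natrD mulrDl; apply: le_trans (lerD (hA1 _) (hB1 _)).
    - by rewrite -natrD ler_nat leq_card_setU.
    - by move=> p; rewrite inE => /hE /andP[? ?]; apply: hBadA.
    - by move=> p; rewrite inE; apply: hBadB.
  by rewrite -hrho mulrAC mulrC ltr_pM2l ?mulr_gt0 // ltr_nat.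
move: zBad; rewrite inE negb_or => /andP[zA' zB'].
pose x' a := if a == o then z else x a.
have x'E (a : 'I_t) : (a < i)%N -> x' a = x a.
  by rewrite /x'; case: eqP => // ->; rewrite ltnn.
have x'o : x' o = z by rewrite /x' eqxx.
have ltS (a : 'I_t) : (a < i.+1)%N -> (a < i)%N \/ a = o.
  by rewrite ltnS leq_eqVlt => /orP[/eqP ai|]; [right; apply: val_inj|left].
exists x'; split.
- move=> a /ltS[ai|->]; first by rewrite x'E // xV.
  by rewrite x'o; apply: (subsetP (ArV o)).
- move=> j k ij jk X Y XV YV cX cY.
  have G' : forall u w, G i x j k u w && (E o j k ==> bl z u w) -> G i.+1 x' j k u w.
    move=> u w /andP[/forallP h1 /implyP h2]; apply/forallP => a.
    apply/implyP => /andP[/ltS[ai Ea|-> Eo]].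
      by rewrite x'E //; have /implyP := h1 a; apply; rewrite ai.
    by rewrite x'o h2.
  apply: le_trans (edge_sum_mono R X Y G').
  case: (boolP (E o j k)) => Eo /=; last first.
    have -> : edge_sum R (fun u w => G i x j k u w && true) X Y =
        edge_sum R (G i x j k) X Y.
      by apply: eq_bigr => u _; apply: eq_bigr => w _; rewrite andbT.
    apply: le_trans (xG j k (ltnW ij) jk X Y XV YV cX cY).
    rewrite !ler_wpM2r // ler_wiXn2l ?(ltW e0) //.
    apply: subset_leq_card; apply/subsetP => a; rewrite !inE => /andP[ai ->].
    by rewrite leqW.
  have zV : z \in V o by apply: (subsetP (ArV o)).
  have zBad : z \notin BadB (j, k).
    apply: contraNN zB' => zB'; apply/bigcupP; exists (j, k) => //.
    by rewrite inE.
  move: zBad; rewrite inE zV /= => /existsPn/(_ (X, Y)).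
  rewrite /sparse /= XV YV cX cY /= -leNgt; apply: le_trans.
  rewrite !ler_wpM2r // ler_wiXn2l ?(ltW e0) //.
  rewrite -add1n /r -[X in (_ <= X)%N](cardsID [set o]) leq_add //.
    by apply/card_gt0P; exists o; rewrite !inE Eo ltnSn eqxx.
  apply: subset_leq_card; apply/subsetP => a; rewrite !inE => /andP[ai ->].
  by rewrite andbT (leqW ai) andbT; apply: contraTneq ai => ->; rewrite ltnn.
- move=> k ik.
  pose N := [set w in A i x k | G i x o k z w].
  have hN : eps ^+ r i o k * #|A i x k|%:R <= #|N|%:R.
    (* [BadA k] was avoided only if some edge has [o] in the middle and [k] last; without such an
       edge the candidates of [k] do not shrink. *)
    case: (boolP [exists a, E a o k]) => [/existsP[a Ea]|/existsPn nE].
      have : z \notin BadA k.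
        apply: contraNN zA' => zA'; apply/bigcupP; exists (a, k) => //.
        by rewrite inE.
      by rewrite inE zA /= -leNgt.
    have -> : r i o k = 0%N.
      by apply: eq_card0 => a; rewrite inE (negPf (nE a)) andbF.
    rewrite expr0 mul1r ler_nat; apply: subset_leq_card; apply/subsetP => w wA.
    rewrite inE wA; apply/forallP => a.
    by rewrite (negPf (nE a)) andbF.
  apply: le_trans (_ : #|N|%:R <= _); last first.
    rewrite ler_nat; apply: subset_leq_card; apply/subsetP => w.
    rewrite !inE => /andP[/andP[-> /forallP hA] /forallP hG] /=.
    apply/forallP => -[a b] /=; apply/implyP => /andP[bi Ek].
    have /andP[ab bk] := hE _ _ _ Ek.
    case: (ltS b bi) => [bi'|bo].
      rewrite !x'E //; last exact: ltn_trans bi'.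
      by have /implyP := hA (a, b); apply; rewrite /= bi'.
    rewrite bo x'o x'E; last by rewrite bo in ab.
    have /implyP := hG a; apply; rewrite -bo Ek andbT.
    by rewrite bo in ab.
  (* Each [a] counted by [r i o k] adds the new pair [(a, o)] to the count [c i.+1 k], which
     accounts for the factor just lost. *)
  apply: le_trans hN; apply: le_trans (_ : eps ^+ (r i o k + c i k) * n%:R <= _).
    rewrite ler_pM2r // ler_wiXn2l ?(ltW e0) //.
    rewrite /c -[X in (_ <= X)%N](cardsID [set p : 'I_t * 'I_t | p.2 == o]) leq_add //.
      rewrite /r -(card_imset _ (f := fun a => (a, o))) => [|a b []//].
      apply: subset_leq_card; apply/subsetP => p /imsetP[a].
      by rewrite inE => /andP[_ Ea] ->; rewrite !inE /= eqxx andbT ltnSn.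
    apply: subset_leq_card; apply/subsetP => p; rewrite !inE => /andP[pi ->].
    by rewrite andbT (leqW pi) andbT; apply: contraTneq pi => ->; rewrite ltnn.
  by rewrite exprD -mulrA ler_wpM2l ?exprn_ge0 ?(ltW e0) // xA // ltnW.
move=> a b k /ltS[ki Ek|-> Eo].
  have /andP[ab bk] := hE _ _ _ Ek.
  have bi := ltn_trans bk ki.
  by rewrite !x'E // ?(ltn_trans ab) // xE.
have /andP[ab bo] := hE _ _ _ Eo.
rewrite x'o !x'E // ?(ltn_trans ab) //.
move: zA; rewrite inE => /andP[_ /forallP/(_ (a, b))/implyP]; apply.
by rewrite /= bo.
Qed.

(** * Choice of the parameters *)

Lemma expR_powR2 (R : realType) (x : R) : expR x = 2 `^ (x / ln 2).
Proof.
have l2 : ln 2 != 0 :> R by rewrite gt_eqF // ln_gt0 // ltr1n.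
by rewrite /powR pnatr_eq0 /= divfK.
Qed.

Lemma ge0_le_expR (R : realType) (x : R) : x <= expR x.
Proof. by apply: le_trans (expR_ge1Dx x); rewrite lerDr. Qed.

(** With [L = s^(2 - del)] and [eps = s^(-del) / 8], the term [eps * s^2] equals [L / 8], and
    [s / be] is of order [s^(1 + 3 d del)]. The latter is at most [L] up to a constant because
    [del * (1 + 3 d) <= 1], which rests on [d <= d^2]. *)
Lemma interval_length_bound (R : realType) (d : nat) :
  exists2 C : R, 0 <= C & forall s : nat, (0 < s)%N ->
    exists eps rho be : R, exists n q : nat,
    [/\ 0 < eps <= 8^-1, rho * d.+1%:R = eps ^+ d /\ 4 * be = eps ^+ d * rho ^+ 2,
        (q <= n)%N /\ 2 * s%:R <= be * q%:R,
        4 ^+ q * (s%:R * (4 / (be * (1 - 4 * eps) ^+ s)) ^+ s.+1) <= be * rho * n%:R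
      & n%:R <= 2 `^ (C * s%:R `^ (2 - 1 / (1 + 3 * d%:R ^+ 2)))].
Proof.
pose del : R := 1 / (1 + 3 * d%:R ^+ 2).
(* [K] is the factor of [be^-1] independent of [s]; see [beV]. *)
pose K : R := 4 * d.+1%:R ^+ 2 * 8 ^+ (3 * d).
have den1 : 1 <= 1 + 3 * d%:R ^+ 2 :> R by rewrite lerDl mulr_ge0 // exprn_ge0.
have den0 : 0 < 1 + 3 * d%:R ^+ 2 :> R by apply: lt_le_trans den1.
have del0 : 0 < del by rewrite divr_gt0.
have del1 : del <= 1 by rewrite /del ler_pdivrMr // mul1r.
have deld : del * (1 + 3 * d%:R) <= 1.
  rewrite /del mulrAC ler_pdivrMr // !mul1r lerD2l ler_pM2l //.
  by rewrite -natrX ler_nat; case: (d) => // k; rewrite expnS expn1 leq_pmulr.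
have K0 : 0 < K by rewrite !mulr_gt0 // exprn_gt0.
have l2 : 0 < ln 2 :> R by rewrite ln_gt0 // ltr1n.
(* The factors of [Z] contribute [8K + 4], [1], [8K], [2], [K] and [K] to the exponent, in total
   [18K + 7]. One more unit absorbs a factor 2 in the bound on [n], and [ln 2] changes the base from
   e to 2. *)
exists ((18 * K + 8) / ln 2); first by rewrite divr_ge0 // ?ltW //; lra.
move=> s s0.
have S1 : 1 <= s%:R :> R by rewrite (ler_nat _ 1%N).
set S : R := s%:R in S1 *.
have S0 : 0 < S by apply: lt_le_trans S1.
have powSD x y : S `^ (x + y) = S `^ x * S `^ y.
  by rewrite powRD // [S == 0]gt_eqF ?implybT.
rewrite -/del; set L := S `^ (2 - del).
pose a := S `^ (- del).
have a0 : 0 < a by rewrite powR_gt0.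
have a1 : a <= 1 by rewrite -(powRr0 S) ler_powR // oppr_le0 ltW.
have aL : a * S ^+ 2 = L.
  by rewrite /a /L addrC powSD powR_mulrn // ltW.
have SL : S <= L.
  by rewrite -[X in X <= _](powRr1 (ltW S0)) ler_powR //; lra.
pose eps := a / 8.
pose rho := eps ^+ d / d.+1%:R.
pose be := eps ^+ d * rho ^+ 2 / 4.
have d0R : 0 < d.+1%:R :> R by rewrite ltr0n.
have d1R : 1 <= d.+1%:R :> R by rewrite (ler_nat _ 1%N).
have e0 : 0 < eps by rewrite divr_gt0.
have e8 : eps <= 8^-1 by rewrite /eps; lra.
have ed0 : 0 < eps ^+ d by rewrite exprn_gt0.
have ed1 : eps ^+ d <= 1 by rewrite exprn_ile1 ?(ltW e0) //; lra.
have rho0 : 0 < rho by rewrite divr_gt0.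
have rho1 : rho <= 1.
  by rewrite ler_pdivrMr // mul1r; apply: le_trans ed1 _.
have be0 : 0 < be by rewrite divr_gt0 // mulr_gt0 // exprn_gt0.
have be_rho : be <= rho.
  have : rho * rho <= rho by rewrite ler_piMr // ltW.
  have : eps ^+ d * rho ^+ 2 <= rho * rho.
    by rewrite expr2 ler_piMl // mulr_ge0 // ltW.
  by rewrite /be; lra.
have beV : be^-1 = K * S `^ (3 * d%:R * del).
  have -> : S `^ (3 * d%:R * del) = a ^- (3 * d).
    rewrite /a -powR_mulrn ?powR_ge0 // -powRN -powRrM natrM; congr (_ `^ _); ring.
  rewrite /be /rho /eps /K !expr_div_n -!exprM mulnC.
  rewrite mulnC !exprM !(exprAC _ _ d).
  have h1 : a ^+ d != 0 by rewrite gt_eqF // exprn_gt0.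
  have h2 : (8 : R) ^+ d != 0 by rewrite gt_eqF // exprn_gt0.
  have h3 : d.+1%:R != 0 :> R by rewrite gt_eqF.
  move: (d.+1%:R) h3 => D h3.
  by field; rewrite h1 h2 h3.
have rhoE : rho * d.+1%:R = eps ^+ d by rewrite /rho divfK ?gt_eqF.
have beE : 4 * be = eps ^+ d * rho ^+ 2 by rewrite /be mulrC divfK ?pnatr_eq0.
have epsE : 8 * eps = a by rewrite /eps mulrC divfK ?pnatr_eq0.
clearbody be rho eps K.
have SbeL : S / be <= K * L.
  rewrite beV mulrCA ler_pM2l // -[X in X * _](powRr1 (ltW S0)) -powSD.
  by rewrite ler_powR //; lra.
pose q := (Num.truncn (2 * S / be)).+1.
have hq : 2 * S <= be * q%:R.
  by rewrite [be * _]mulrC -ler_pdivrMr // ltW // truncnS_gt.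
have qL : q%:R <= (2 * K + 1) * L.
  have : (Num.truncn (2 * S / be))%:R <= 2 * S / be.
    by rewrite truncn_le divr_ge0 ?(ltW be0) // mulr_ge0 // ltW.
  rewrite /q -natr1; lra.
(* [Z] is the least real block length that satisfies the main inequality. *)
pose Z := 4 ^+ q * (S * (4 / (be * (1 - 4 * eps) ^+ s)) ^+ s.+1) / (be * rho).
pose n := (q + (Num.truncn Z).+1)%N.
have beVL : be^-1 <= K * L.
  by apply: le_trans SbeL; rewrite ler_peMl // invr_ge0 ltW.
have l0 : 0 < 1 - 4 * eps by lra.
(* This is [1 <= (1 - 4 eps) (1 + 8 eps)], valid for [eps <= 1/8]. *)
have lV : (1 - 4 * eps)^-1 <= expR (8 * eps).
  apply: le_trans (expR_ge1Dx _); rewrite -[X in X <= _]mul1r ler_pdivrMr //.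
  have : 0 <= eps * (1 - 8 * eps) by rewrite mulr_ge0 ?(ltW e0) //; lra.
  lra.
have S2 : (s.+1)%:R <= 2 * S by rewrite -natr1 -/S; lra.
have pow_expR (x y : R) k : 0 <= x -> x <= expR y -> x ^+ k <= expR (k%:R * y).
  by move=> x0 xy; rewrite expRM_natl lerXn2r // nnegrE ?expR_ge0.
have hZ : Z <= expR ((18 * K + 7) * L).
  have h1 : 4 ^+ q <= expR (4 * (2 * K + 1) * L).
    apply: le_trans (pow_expR _ 4 q _ (ge0_le_expR _)) _ => //.
    by rewrite ler_expR; lra.
  have h2 : S <= expR L by apply: le_trans SL (ge0_le_expR _).
  have h3 : (4 / be) ^+ s.+1 <= expR (8 * K * L).
    apply: le_trans (pow_expR _ (4 / be) _ _ (ge0_le_expR _)) _.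
      by rewrite divr_ge0 // ltW.
    rewrite ler_expR; apply: le_trans (_ : 2 * S * (4 / be) <= _).
      by rewrite ler_wpM2r // divr_ge0 // ltW.
    by move: SbeL; lra.
  have h4 : ((1 - 4 * eps) ^- s) ^+ s.+1 <= expR (2 * L).
    rewrite -exprVn -exprM.
    apply: le_trans (pow_expR _ _ (s * s.+1)%N _ lV) _.
      by rewrite invr_ge0 ltW.
    rewrite ler_expR natrM -/S -aL -epsE.
    have : S * s.+1%:R <= S * (2 * S) by rewrite ler_pM2l.
    move/(ler_wpM2r (ltW e0)); rewrite expr2; lra.
  have h5 : be^-1 <= expR (K * L) by apply: le_trans beVL (ge0_le_expR _).
  have h6 : rho^-1 <= expR (K * L).
    by apply: le_trans h5; rewrite lef_pV2.
  have -> : Z = 4 ^+ q * (S * ((4 / be) ^+ s.+1 * ((1 - 4 * eps) ^- s) ^+ s.+1)) *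
      (be^-1 * rho^-1).
    by rewrite /Z !invfM -exprMn !mulrA.
  have -> : (18 * K + 7) * L =
      4 * (2 * K + 1) * L + (L + (8 * K * L + 2 * L)) + (K * L + K * L) by ring.
  have v0 : 0 <= (1 - 4 * eps) ^- s by rewrite invr_ge0 exprn_ge0 // ltW.
  have u0 : 0 <= 4 / be by rewrite divr_ge0 // ltW.
  have b0 : 0 <= be^-1 by rewrite invr_ge0 ltW.
  have c0 : 0 <= rho^-1 by rewrite invr_ge0 ltW.
  have S0' := ltW S0.
  by rewrite !expRD !ler_pM ?mulr_ge0 ?exprn_ge0.
exists eps, rho, be, n, q; split.
- by rewrite e0.
- by [].
- by rewrite leq_addr.
- rewrite [be * _ * _]mulrC -ler_pdivrMr ?mulr_gt0 // -/Z ltW //.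
  by apply: lt_le_trans (truncnS_gt _) _; rewrite ler_nat leq_addl.
rewrite -mulrA [_^-1 * _]mulrC mulrA -expR_powR2.
have Z0 : 0 <= Z.
  rewrite /Z divr_ge0 ?mulr_ge0 ?exprn_ge0 ?(ltW S0) ?(ltW be0) ?(ltW rho0) //.
  by rewrite divr_ge0 // mulr_ge0 ?(ltW be0) // exprn_ge0 // ltW.
have n_le : n%:R <= (2 * K + 2) * L + Z.
  have : (Num.truncn Z)%:R <= Z by rewrite truncn_le.
  rewrite natrD -natr1; lra.
have KL : 0 <= K * L by rewrite mulr_ge0 ?(ltW K0) //; lra.
have h7 : (2 * K + 2) * L <= expR ((18 * K + 7) * L).
  by apply: le_trans (ge0_le_expR _) _; rewrite ler_expR; lra.
have -> : (18 * K + 8) * L = (18 * K + 7) * L + L by ring.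
rewrite expRD; apply: le_trans (_ : expR ((18 * K + 7) * L) * 2 <= _).
  lra.
rewrite ler_pM2l ?expR_gt0 //; apply: le_trans (expR_ge1Dx _); lra.
Qed.

(** * Ordered hypergraphs and blocks of vertices *)

Lemma increasing_enum (disp : Order.disp_t) (T : finOrderType disp)
    (A : {set T}) (s : nat) :
  #|A| = s -> exists e : 'I_s -> T, [/\ forall i, e i \in A,
    forall u, u \in A -> exists i, e i = u &
    forall i j : 'I_s, (i < j)%N -> (e i < e j)%O].
Proof.
move=> <-; exists (@Order.enum_val _ _ (mem A)); split.
- by move=> i; apply: Order.enum_valP.
- by move=> u uA; exists (Order.enum_rank_in uA u); rewrite Order.enum_rankK_in.
move=> i j ij.
by rewrite (leW_mono (@Order.le_enum_val _ _ (@le_total _ T) (mem A))).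
Qed.

(** The copy is the image of [H] under [g], which is injective on [verts H] because the order is
    total. The isomorphism goes from the copy back to [H], so it is a left inverse of [g], with [z0]
    as the default value off the image. *)
Lemma has_mono_of_embedding (k N : nat) (disp : Order.disp_t)
    (T : finOrderType disp) (H : ohgraph k T) (col : {set 'I_N} -> bool)
    (b : bool) (g : T -> 'I_N) (z0 : T) :
  {in verts H &, forall x y, (x < y)%O -> (g x < g y)%N} ->
  (forall e, e \in edges H -> col (g @: e) = b) -> has_mono col b H.
Proof.
move=> gmono gcol.
have ginj : {in verts H &, injective g}.
  move=> x y xV yV gxy; case: (ltgtP x y) => // xy.
    by have := gmono _ _ xV yV xy; rewrite gxy ltnn.
  by have := gmono _ _ yV xV xy; rewrite gxy ltnn.
have edgesP' (e : {set 'I_N}) :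
    e \in [set g @: (e : {set T}) | e in edges H] ->
    e \subset g @: verts H /\ #|e| = k.
  case/imsetP => e' e'H ->; have [e'V e'k] := edgesP e'H; split.
    exact: imsetS.
  rewrite -[RHS]e'k; apply: card_in_imset => x y.
  by move=> /(subsetP e'V) xV /(subsetP e'V); apply: ginj.
pose f u := odflt z0 [pick v in verts H | g v == u].
have fK v : v \in verts H -> f (g v) = v.
  move=> vV; rewrite /f; case: pickP => [w /andP[wV /eqP gwv]|/(_ v)].
    exact: ginj.
  by rewrite vV eqxx.
exists (OHGraph edgesP'); split.
- split; apply/subsetP => e; rewrite ?inE // => /edgesP' [_ /eqP] //.
- by move=> _ /imsetP[e' e'H ->]; apply: gcol.
exists f; split.
- move=> _ _ /imsetP[x xV ->] /imsetP[y yV ->]; rewrite !fK //.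
  case: (ltgtP x y) => [xy|yx|->]; last by rewrite ltxx.
    exact/esym/(gmono _ _ xV yV xy).
  by apply/esym/negbTE; rewrite -leNgt; apply/ltW/(gmono _ _ yV xV yx).
- rewrite /= -imset_comp -[RHS]imset_id; apply: eq_in_imset => v vV /=.
  exact: fK.
rewrite /= -imset_comp -[RHS]imset_id; apply: eq_in_imset => e eH /=.
rewrite -imset_comp -[RHS]imset_id; apply: eq_in_imset => v ve /=.
by have [/subsetP eV _] := edgesP eH; apply/fK/eV.
Qed.

Definition block (t n : nat) (i : 'I_t) : {set 'I_(t * n)} :=
  [set v : 'I_(t * n) | (i * n <= v < i.+1 * n)%N].

Lemma card_block (t n : nat) (i : 'I_t) : #|block n i| = n.
Proof.
have lt (j : 'I_n) : (i * n + j < t * n)%N.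
  have := ltn_ord i; have := ltn_ord j; nia.
rewrite (_ : block n i = [set Ordinal (lt j) | j in 'I_n]).
  by rewrite card_imset ?card_ord // => j j' /(congr1 val) /= /addnI /val_inj.
apply/setP => v; rewrite inE; apply/idP/imsetP => [iv|[j _ ->]] /=.
  have vn : (v - i * n < n)%N by move: iv; lia.
  by exists (Ordinal vn) => //; apply: val_inj => /=; move: iv; lia.
by have := ltn_ord j; lia.
Qed.

Lemma block_lt (t n : nat) (i j : 'I_t) (u v : 'I_(t * n)) :
  (i < j)%N -> u \in block n i -> v \in block n j -> (u < v)%N.
Proof. by rewrite !inE; nia. Qed.

(** The quotient of a vertex by [s] tells which of [A], [B], [C] it is sent to, the remainder its
    rank there. The order of the three blocks makes this map increasing. *)
Lemma has_mono_tripartite (t n s : nat) (col : {set 'I_(t * n)} -> bool)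
    (i j k : 'I_t) :
  (i < j)%N -> (j < k)%N -> (0 < s)%N ->
  red_tripartite (fun x y z => col [set x; y; z]) s
    (block n i) (block n j) (block n k) ->
  has_mono col false (otripartite s).
Proof.
move=> ij jk s0 [A [B [C [/subsetP Ai /subsetP Bj /subsetP Ck [cA cB cC] red]]]].
have [eA [eAP _ eAlt]] := increasing_enum cA.
have [eB [eBP _ eBlt]] := increasing_enum cB.
have [eC [eCP _ eClt]] := increasing_enum cC.
have lt_mod m : (m %% s < s)%N by rewrite ltn_pmod.
pose g (p : 'I_(3 * s)) := let r := Ordinal (lt_mod p) in
  if (p %/ s == 0)%N then eA r else if (p %/ s == 1)%N then eB r else eC r.
have div3 (p : 'I_(3 * s)) : (p %/ s < 3)%N by rewrite ltn_divLR.
have s30 : (0 < 3 * s)%N by rewrite muln_gt0.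
apply: (@has_mono_of_embedding _ _ _ _ _ _ _ g (Ordinal s30)).
  move=> p q _ _ pq.
  have {}pq : (p < q)%N by [].
  have AB x y : x \in A -> y \in B -> (x < y)%N.
    by move=> /Ai xi /Bj yj; apply: block_lt xi yj.
  have BC x y : x \in B -> y \in C -> (x < y)%N.
    by move=> /Bj xi /Ck yj; apply: block_lt xi yj.
  have AC x y : x \in A -> y \in C -> (x < y)%N.
    by move=> /Ai xi /Ck yj; apply: block_lt xi yj; apply: ltn_trans jk.
  have := leq_div2r s (ltnW pq).
  have qs : (p %/ s = q %/ s -> p %% s < q %% s)%N.
    move=> E; move: pq.
    by rewrite (divn_eq p s) (divn_eq q s) E ltn_add2l !modnMDl !modn_mod.
  have := div3 q; rewrite /g.
  move: qs; case: (p %/ s)%N => [|[|[|p']]]; case: (q %/ s)%N => [|[|[|q']]] //= qs _ _.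
  - by apply: eAlt; apply: qs.
  - exact: AB.
  - exact: AC.
  - by apply: eBlt; apply: qs.
  - exact: BC.
  - by apply: eClt; apply: qs.
move=> e; rewrite inE => /andP[_ /forallP he].
have [u0 hu0] := cards1P (he 0); have [u1 hu1] := cards1P (he 1).
have [u2 hu2] := cards1P (he 2).
have mem (i0 : 'I_3) (u : 'I_(3 * s)) : 
    e :&: Defs.interval s i0 = [set u] -> u \in e /\ (u %/ s)%N = i0.
  move=> h; have : u \in e :&: Defs.interval s i0 by rewrite h inE.
  rewrite !inE => /andP[-> /andP[h1 h2]]; split=> //.
  apply/eqP; rewrite eqn_leq -ltnS ltn_divLR // h2 /=.
  by rewrite leq_divRL.
have [u0e q0] := mem _ _ hu0; have [u1e q1] := mem _ _ hu1.
have [u2e q2] := mem _ _ hu2.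
have -> : g @: e = [set g u0; g u1; g u2].
  have -> : e = [set u0; u1; u2].
    apply/setP => u; rewrite !inE; apply/idP/idP => [ue|]; last first.
      by move=> /orP[/orP[]|] /eqP ->.
    have : u \in e :&: Defs.interval s (Ordinal (div3 u)).
      rewrite !inE ue /= leq_divM /= -ltn_divLR //.
    have := div3 u; case E : (u %/ s)%N (div3 u) => [|[|[|r]]] // r3 _.
    - by rewrite (_ : Ordinal r3 = 0) ?hu0 ?inE => [->//|]; apply: val_inj.
    - by rewrite (_ : Ordinal r3 = 1) ?hu1 ?inE => [->|]; rewrite ?orbT //; apply: val_inj.
    by rewrite (_ : Ordinal r3 = 2) ?hu2 ?inE => [->|]; rewrite ?orbT //; apply: val_inj.
  by rewrite !imsetU !imset_set1.
by apply/negbTE; apply: red; rewrite /g ?q0 ?q1 ?q2 /=.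
Qed.

(** Requiring increasing indices represents each hyperedge by one triple only, so counting triples
    does not exceed the degree. *)
Definition ordered_edge (disp : Order.disp_t) (T : finOrderType disp)
    (H : ohgraph 3 T) (t : nat) (v : 'I_t -> T) (a b k : 'I_t) : bool :=
  [&& (a < b)%N, (b < k)%N & [set v a; v b; v k] \in edges H].

Lemma card_ordered_edges (disp : Order.disp_t) (T : finOrderType disp)
    (H : ohgraph 3 T) (t : nat) (v : 'I_t -> T) (i : 'I_t)
    (S : {set 'I_t * 'I_t * 'I_t}) :
  injective v ->
  (forall a b k, (a, b, k) \in S ->
     ordered_edge H v a b k && [|| i == a, i == b | i == k]) ->
  (#|S| <= degree H (v i))%N.
Proof.
move=> vinj hS.
rewrite -(card_in_imset (f := fun p => [set v p.1.1; v p.1.2; v p.2])).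
  apply: subset_leq_card; apply/subsetP => e /imsetP[[[a b] k] /hS + ->] /=.
  move=> /andP[/and3P[_ _ eH] hi]; rewrite inE eH /= !inE.
  by case/or3P: hi => /eqP ->; rewrite eqxx ?orbT.
move=> [[a b] k] [[a' b'] k'] /hS /andP[/and3P[ab bk _] _].
move=> /hS /andP[/and3P[ab' bk' _] _] /= E.
have mem x : (x \in [set a; b; k]) = (x \in [set a'; b'; k']).
  by have /setP/(_ (v x)) := E; rewrite !inE !(inj_eq vinj).
have := mem a; have := mem b; have := mem k; have := mem a'; have := mem b'.
have := mem k'; rewrite !inE !eqxx ?orbT /= -!(inj_eq val_inj) /=.
move=> h1 h2 h3 h4 h5 h6.
by congr (_, _, _); apply: val_inj => /=; lia.
Qed.

(** Either some three blocks contain a red tripartite subhypergraph, or none do and the greedy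
    embedding places one vertex of [H] in each block. *)
Lemma oarrows_blocks (R : realType) (d n q s : nat) (eps rho be : R)
    (disp : Order.disp_t) (T : finOrderType disp) (H : ohgraph 3 T) :
  0 < eps <= 8^-1 -> rho * d.+1%:R = eps ^+ d -> 4 * be = eps ^+ d * rho ^+ 2 ->
  (0 < s)%N -> (q <= n)%N -> 2 * s%:R <= be * q%:R ->
  4 ^+ q * (s%:R * (4 / (be * (1 - 4 * eps) ^+ s)) ^+ s.+1) <= be * rho * n%:R ->
  (0 < #|verts H|)%N -> (max_degree H <= d)%N ->
  oarrows (#|verts H| * n) H (otripartite s).
Proof.
move=> heps hrho hbe s0 qn hq hn t0 Hd col.
set t := #|verts H| in t0 col *.
pose bl x y z := col [set x; y; z].
have [[i [j [k [ij jk red]]]]|nored] := EM (exists i j k : 'I_t,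
    [/\ (i < j)%N, (j < k)%N &
        red_tripartite bl s (block n i) (block n j) (block n k)]).
  by right; apply: has_mono_tripartite red.
left.
have [v [vV vsurj vlt]] := increasing_enum (erefl t).
have vinj : injective v.
  move=> i j vij; apply: val_inj; case: (ltngtP i j) => //= /vlt.
    by rewrite vij ltxx.
  by rewrite vij ltxx.
have deg i : (degree H (v i) <= d)%N.
  by apply: leq_trans Hd; rewrite /max_degree (bigD1 (v i)) //= leq_maxl.
have q0 : (0 < q)%N.
  case: (posnP q) hq => // ->; rewrite mulr0 leNgt mulr_gt0 //.
  by rewrite ltr0n.
have n0 := leq_trans q0 qn.
have tn0 : (0 < t * n)%N by rewrite muln_gt0 t0.
have [|||||x [xV xE]] := @greedy_embedding R 'I_(t * n) bl t n d s q (@block t n)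
  (ordered_edge H v) eps rho be (Ordinal tn0) heps hrho hbe s0 qn hq hn.
- by move=> a b k /and3P[-> ->].
- move=> k; apply: leq_trans (deg k).
  rewrite -(card_imset _ (f := fun p => (p.1, p.2, k))) => [|[a b] [a' b'] [-> ->]//].
  apply: card_ordered_edges => // a b k' /imsetP[[a' b']].
  by rewrite inE => /= E [-> -> ->]; rewrite E eqxx !orbT.
- move=> i; apply: leq_trans (deg i).
  rewrite -(card_imset _ (f := fun p => (p.1, i, p.2))) => [|[a b] [a' b'] [-> ->]//].
  rewrite -[X in (_ + X)%N](card_imset _ (f := fun p => (i, p.1, p.2)))
    => [|[a b] [a' b'] [-> ->]//].
  set S1 := imset _ _; set S2 := imset _ _.
  (* [S1] has [i] in the middle and [S2] has it in front, so the two counts add up to at most one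
     degree. *)
  have S12 : S1 :&: S2 = set0.
    apply/setP => p; rewrite !inE; apply/negbTE/negP.
    move=> /andP[/imsetP[[a k]]]; rewrite inE /= => /and3P[ai _ _] ->.
    by move=> /imsetP[[b k']] _ [ia]; rewrite ia ltnn in ai.
  have -> : (#|S1| + #|S2| = #|S1 :|: S2|)%N by rewrite cardsU S12 cards0 subn0.
  apply: card_ordered_edges => // a b k; rewrite inE => /orP[] /imsetP[[a' b']].
    by rewrite inE => /= E [-> -> ->]; rewrite E eqxx !orbT.
  by rewrite inE => /= E [-> -> ->]; rewrite E eqxx.
- by move=> i; apply: card_block.
- by move=> i j k /andP[ij jk] red; apply: nored; exists i, j, k.
pose g u := odflt (Ordinal tn0) (omap x [pick i | v i == u]).
have gv i : g (v i) = x i.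
  by rewrite /g; case: pickP => [j /eqP/vinj ->//|/(_ i)]; rewrite eqxx.
apply: (@has_mono_of_embedding _ _ _ _ _ _ _ g (v (Ordinal t0))).
  move=> u w /vsurj[i <-] /vsurj[j <-] vij; rewrite !gv.
  apply: block_lt (xV i) (xV j); rewrite ltnNge leq_eqVlt.
  apply/negP => /orP[/eqP/val_inj ji|/vlt ji].
    by rewrite ji ltxx in vij.
  by have := lt_trans vij ji; rewrite ltxx.
move=> e eH; have [/subsetP eV e3] := edgesP eH.
have pre3 : #|v @^-1: e| = 3.
  rewrite -(card_imset _ vinj) (_ : v @: _ = e) //.
  apply/setP => u; apply/imsetP/idP => [[i]|ue]; first by rewrite inE => ie ->.
  by have [i vi] := vsurj _ (eV _ ue); exists i; rewrite ?inE ?vi.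
have [w [wP wsurj wlt]] := increasing_enum pre3.
have eE : e = [set v (w 0); v (w 1); v (w 2)].
  apply/setP => u; rewrite !inE; apply/idP/idP => [ue|].
    have [i vi] := vsurj _ (eV _ ue).
    have [|j wj] := wsurj i; first by rewrite inE vi.
    rewrite -vi -wj; case: j {wj} => [[|[|[|m]]]] // lt3.
    - by rewrite (_ : Ordinal lt3 = 0) ?eqxx //; apply: val_inj.
    - by rewrite (_ : Ordinal lt3 = 1) ?eqxx ?orbT //; apply: val_inj.
    by rewrite (_ : Ordinal lt3 = 2) ?eqxx ?orbT //; apply: val_inj.
  by move=> /orP[/orP[]|] /eqP ->; have := wP 0; have := wP 1; have := wP 2;
    rewrite !inE.
rewrite eE !imsetU !imset_set1 !gv.
apply: xE; apply/and3P; split; [exact: wlt|exact: wlt|by rewrite -eE].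
Qed.

(** * Existence of the ordered Ramsey number and the final bounds *)

Lemma exists_ordered_ramsey (k M : nat) (disp1 disp2 : Order.disp_t)
    (T1 : finOrderType disp1) (T2 : finOrderType disp2)
    (H : ohgraph k T1) (G : ohgraph k T2) :
  oarrows M H G -> exists2 N, is_ordered_ramsey H G N & (N <= M)%N.
Proof.
move=> hM; have ex : exists m, `[< oarrows m H G >] by exists M; apply/asboolP.
case: (ex_minnP ex) => N /asboolP hN minN; exists N.
  by split=> // m hm; apply: minN; apply/asboolP.
by apply: minN; apply/asboolP.
Qed.

Lemma ordered_ramsey_bound (R : realType) (d : nat) :
  exists2 C : R, 0 <= C &
    forall (disp : Order.disp_t) (T : finOrderType disp) (H : ohgraph 3 T) (s : nat),
      (0 < #|verts H|)%N -> max_degree H = d -> (0 < s)%N ->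
      exists2 N : nat, is_ordered_ramsey H (otripartite s) N &
        N%:R <= #|verts H|%:R * 2 `^ (C * s%:R `^ (2 - 1 / (1 + 3 * d%:R ^+ 2))).
Proof.
have [C C0 hC] := interval_length_bound R d; exists C => // disp T H s t0 Hd s0.
have [eps [rho [be [n [q [he [hrho hbe] [qn hq] hn nC]]]]]] := hC s s0.
have arrows : oarrows (#|verts H| * n) H (otripartite s).
  by apply: (oarrows_blocks he hrho hbe) hn _ _; rewrite // Hd.
have [N NR NM] := exists_ordered_ramsey arrows; exists N => //.
apply: le_trans (_ : (#|verts H| * n)%:R <= _); first by rewrite ler_nat.
by rewrite natrM ler_wpM2l.
Qed.

Lemma verts_gt0 (disp : Order.disp_t) (T : finOrderType disp) (H : ohgraph 3 T) :
  (0 < max_degree H)%N -> (0 < #|verts H|)%N.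
Proof.
apply: contraLR; rewrite -!leqNgt leqn0 cards_eq0 => /eqP V0.
by rewrite /max_degree V0 big_set0.
Qed.

Theorem theorem1 (R : realType) :
  exists2 c : R, 0 < c &
    (forall d : nat, (0 < d)%N ->
      exists C : R,
        forall (disp : Order.disp_t) (T : finOrderType disp)
               (H : ohgraph 3 T) (t s : nat),
          #|verts H| = t -> max_degree H = d -> (0 < s)%N ->
          exists2 N : nat, is_ordered_ramsey H (otripartite s) N &
            N%:R <= t%:R * 2 `^ (C * s%:R `^ (2 - 1 / (1 + c * d%:R ^+ 2))))
    /\
    (forall D : nat,
      exists C : R,
        forall (d n : nat) (disp : Order.disp_t) (T : finOrderType disp)
               (H : ohgraph 3 T),
          (0 < d <= D)%N -> (0 < n)%N ->
          #|verts H| = n -> max_degree H = d ->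
          exists2 N : nat, is_ordered_ramsey H (otripartite n) N &
            N%:R <= 2 `^ (C * n%:R `^ (2 - 1 / (1 + c * d%:R ^+ 2)))).
Proof.
(* The 3 is the exponent in [be], which is of order [eps ^+ (3 * d)]. *)
exists 3 => //; split.
  move=> d d0; have [C C0 hC] := ordered_ramsey_bound R d.
  exists C => disp T H t s <- Hd s0.
  by apply: hC => //; apply: verts_gt0; rewrite Hd.
move=> D.
(* Adding up the nonnegative constants of the degrees up to [D] gives one that serves them all. *)
have [C C0 hC] : exists2 C : R, 0 <= C & forall d : nat, (d <= D)%N ->
    forall (disp : Order.disp_t) (T : finOrderType disp) (H : ohgraph 3 T) (s : nat),
      (0 < #|verts H|)%N -> max_degree H = d -> (0 < s)%N ->
      exists2 N : nat, is_ordered_ramsey H (otripartite s) N &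
        N%:R <= #|verts H|%:R * 2 `^ (C * s%:R `^ (2 - 1 / (1 + 3 * d%:R ^+ 2))).
  elim: D => [|D [C1 C10 h1]].
    have [C C0 hC] := ordered_ramsey_bound R 0; exists C => // d.
    by rewrite leqn0 => /eqP ->.
  have [C2 C20 h2] := ordered_ramsey_bound R D.+1.
  exists (C1 + C2); first exact: addr_ge0.
  have mono d s C t : (C <= C1 + C2) ->
      t%:R * 2 `^ (C * s%:R `^ (2 - 1 / (1 + 3 * d%:R ^+ 2))) <=
      t%:R * 2 `^ ((C1 + C2) * s%:R `^ (2 - 1 / (1 + 3 * d%:R ^+ 2))) :> R.
    by move=> CC; rewrite ler_wpM2l // ler_powR ?ler1n // ler_wpM2r ?powR_ge0.
  move=> d; rewrite leq_eqVlt => /orP[/eqP ->|dD] disp T H s V0 Hd s0.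
    have [N NR NC] := h2 disp T H s V0 Hd s0; exists N => //.
    by apply: le_trans NC (mono _ _ _ _ _); rewrite lerDr.
  have [N NR NC] := h1 d dD disp T H s V0 Hd s0; exists N => //.
  by apply: le_trans NC (mono _ _ _ _ _); rewrite lerDl.
(* The additional 1 absorbs the factor [t = n]: it is at most [2 ^ n], and the exponent of [n] in
   the bound is at least 1. *)
exists (C + 1) => d n disp T H /andP[_ dD] n0 Hn Hd.
have V0 : (0 < #|verts H|)%N by rewrite Hn.
have [N NR NC] := hC d dD disp T H n V0 Hd n0; exists N => //.
apply: le_trans NC _; rewrite Hn; set L := _ `^ (2 - _).
rewrite mulrDl mul1r powRD ?pnatr_eq0 ?implybT //.
rewrite [X in _ <= X]mulrC ler_wpM2r ?powR_ge0 //.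
have n1 : 1 <= n%:R :> R by rewrite (ler_nat _ 1%N).
apply: le_trans (_ : 2 `^ n%:R <= _).
  by rewrite powR_mulrn // -natrX ler_nat ltnW // ltn_expl.
rewrite ler_powR ?ler1n // -[X in X <= _](powRr1 (ler0n R n)) ler_powR //.
have den1 : 1 <= 1 + 3 * d%:R ^+ 2 :> R by rewrite lerDl mulr_ge0 // exprn_ge0.
have : 1 / (1 + 3 * d%:R ^+ 2) <= 1 :> R.
  by rewrite ler_pdivrMr ?mul1r // (lt_le_trans ltr01).
lra.
Qed.
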